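(* Let $q$ be a prime power with $q>9$ if $q$ is odd and $q>2$ if $q$ is even. Let $U$ be an intersecting family of polynomials over $\mathbb{F}_q$ of degree at most $2$. If \[|U|>q^2-\frac{q\sqrt{q}}{4}+\frac{cq}{8}+\frac{\sqrt{q}}{8},\] where $c=1$ if $q$ is even and $c=3$ if $q$ is odd, then the graphs of the polynomials in $U$ share a common point, i.e. there exist $\alpha,\beta\in\mathbb{F}_q$ with $g(\alpha)=\beta$ for all $g\in U$.
   Context: For a function $f\colon\mathbb{F}_q\to\mathbb{F}_q$ its graph is $U_f=\{(x,f(x)) : x\in\mathbb{F}_q\}\subseteq\mathbb{F}_q^2$. A set $U$ of polynomials over $\mathbb{F}_q$ is intersecting if for any two $f_1,f_2\in U$ the graphs of $f_1$ and $f_2$ share at least one point. *)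

(* Defs.v *)
From Stdlib Require Import Reals.
From mathcomp Require Import all_boot all_algebra all_field.
Set Implicit Arguments. Unset Strict Implicit. Unset Printing Implicit Defensive.
Import GRing.Theory.
Local Open Scope ring_scope.

Definition poly_graph (F : finFieldType) (f : {poly F}) : {set F * F} :=
  [set (x, f.[x]) | x : F].

(* A finite family of polynomials is represented by a duplicate-free list. *)
Definition intersecting (F : finFieldType) (U : seq {poly F}) : Prop :=
  forall f1 f2, f1 \in U -> f2 \in U -> poly_graph f1 :&: poly_graph f2 != set0.

Local Open Scope R_scope.
Definition intersect_bound (q : nat) : R :=
  let qr := INR q in
  let c : R := if odd q then 3 else 1 in
  Rplus (Rplus (Rminus (Rmult qr qr) (Rdiv (Rmult qr (sqrt qr)) 4))
               (Rdiv (Rmult c qr) 8))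
        (Rdiv (sqrt qr) 8).

(* Main.v *)
(* Identify a polynomial of degree at most 2 with its coefficients, write q = #|F| and N = #|U|, and
   weight each point by w = (number of members of U through it) - N / q. Summing w over the graph
   of f gives W f, the total number of intersections of f with members of U minus N. As the values
   of a random quadratic polynomial at three points are independent, the third moment of W over all
   q^3 polynomials is that of the point weights, so it is at most (max w) times the second moment.
   On U itself W averages to A, which is close to q^2: two members of U meet exactly once only if
   they have the same leading coefficient or are tangent, and such pairs are rare. Comparing moments
   forces a point of large weight. But a polynomial of U missing a point P meets fewer than
   q(q + 1) / 2 polynomials through P, so every member of U passes through that point. *)
Require Import Defs.
From Stdlib Require Import Reals Lra Psatz.
From mathcomp Require Import all_boot all_order all_algebra all_field.
Set Implicit Arguments. Unset Strict Implicit. Unset Printing Implicit Defensive.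

(** * Square-root-free consequences of the size bound *)

Section RealBounds.
Local Open Scope R_scope.

Lemma INR_le_nat (m n : nat) : INR m <= INR n -> (m <= n)%N.
Proof. by move/INR_le/leP. Qed.

(** With [s] the square root of [q], the size bound minus [25 / 26 * q ^ 2] is [s / 104] times a
    cubic in [s] that is positive for [s >= 0]. *)
Lemma bound_odd (q N : nat) : odd q -> (11 <= q)%N -> intersect_bound q < INR N ->
  (26 * q ^ 2 <= q ^ 2 + 26 * N)%N.
Proof.
move=> oq /leP/le_INR q11; rewrite /intersect_bound oq => h; apply: INR_le_nat.
rewrite !expnS expn0 muln1 -plusE -multE plus_INR !mult_INR.
have q0 := pos_INR q; have s0 := sqrt_pos (INR q); have ss := sqrt_sqrt _ q0.
move: q11 h s0; rewrite (INR_IZR_INZ 11) (INR_IZR_INZ 26) /=.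
move: ss; move: (sqrt (INR q)) => s; move: (INR q) (INR N) q0 => x n q0 ss q11 h s0.
have cubic : 0 <= 4 * s * s * s - 26 * s * s + 39 * s + 13.
  (* [337 / 100] approximates the local minimum of the cubic. *)
  have h1 := Rmult_le_pos _ _ s0 (Rle_0_sqr (s - 337 / 100)).
  have h2 := Rle_0_sqr (s - 337 / 100); rewrite /Rsqr in h1 h2; nra.
have := Rmult_le_pos _ _ s0 cubic; rewrite -ss in h *; nra.
Qed.

Lemma bound_even (q N : nat) : ~~ odd q -> (16 <= q)%N -> intersect_bound q < INR N ->
  (16 * q ^ 2 <= q ^ 2 + 16 * N)%N.
Proof.
move=> oq /leP/le_INR q16; rewrite /intersect_bound (negbTE oq) => h; apply: INR_le_nat.
rewrite !expnS expn0 muln1 -plusE -multE plus_INR !mult_INR.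
have q0 := pos_INR q; have s0 := sqrt_pos (INR q); have ss := sqrt_sqrt _ q0.
move: q16 h s0; rewrite (INR_IZR_INZ 16) /=.
move: ss; move: (sqrt (INR q)) => s; move: (INR q) (INR N) q0 => x n q0 ss q16 h s0.
have s4 : 4 <= s by nra.
have cubic : 0 <= s * s * s - 4 * s * s + 2 * s + 2 by nra.
have := Rmult_le_pos _ _ s0 cubic; rewrite -ss in h *; nra.
Qed.

(** The bound is about [59.7]; integrality lifts it to [60], exactly [15 / 16 * 8 ^ 2]. The cubic in
    [bound_even] is negative at [q = 8], so that argument does not reach this case. *)
Lemma bound8 (N : nat) : intersect_bound 8 < INR N -> (60 <= N)%N.
Proof.
rewrite /intersect_bound (INR_IZR_INZ 8) /= => h; have h59 : 59 < INR N.
  have := sqrt_sqrt 8 ltac:(lra); have := sqrt_pos 8; set s := sqrt 8 in h *; nra.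
apply/ltP/INR_lt; rewrite (INR_IZR_INZ 59); exact: h59.
Qed.

Lemma bound4 (N : nat) : intersect_bound 4 < INR N -> (15 <= N)%N.
Proof.
rewrite /intersect_bound (INR_IZR_INZ 4) /= => h; have h14 : 14 < INR N.
  have := sqrt_sqrt 4 ltac:(lra); have := sqrt_pos 4; set s := sqrt 4 in h *; nra.
apply/ltP/INR_lt; rewrite (INR_IZR_INZ 14); exact: h14.
Qed.

End RealBounds.

From mathcomp Require Import ring lra zify.
Import Order.TTheory GRing.Theory Num.Theory.
Local Open Scope ring_scope.

(** * Moments over all quadratic polynomials *)

Definition ev (F : finFieldType) (f : F * F * F) (x : F) : F :=
  f.1.1 * x ^+ 2 + f.1.2 * x + f.2.

Section Correlation.
Variables (F : finFieldType) (K : realFieldType).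
Implicit Types (f g : F * F * F) (x y : F).
Notation V := (F * F * F)%type.
Notation q := (#|F|%:R : K).

Lemma evD f g x : ev (f + g) x = ev f x + ev g x.
Proof. by rewrite /ev /=; ring. Qed.

Lemma sum_translate (e : V) (phi : V -> K) : \sum_(f : V) phi (f + e) = \sum_(f : V) phi f.
Proof. by rewrite [RHS](reindex_inj (addIr e)). Qed.

(** Translating [f] by [e t], the coefficients of [t (X - x') (X - x'')], fixes its values at [x']
    and [x''] while its value at [x] runs once through the field, so averaging over [t] kills [h].
    The points [x'] and [x''] may coincide. *)
Lemma sum_ev_orth (h : F -> K) (G : F -> F -> K) x x' x'' :
  x != x' -> x != x'' -> \sum_y h y = 0 ->
  \sum_(f : V) h (ev f x) * G (ev f x') (ev f x'') = 0.
Proof.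
move=> xx' xx'' h0; set S := \sum_(f : V) _.
pose e t : V := (t, - t * (x' + x''), t * x' * x'').
have St t : S = \sum_(f : V) h (ev f x + t * ((x - x') * (x - x''))) * G (ev f x') (ev f x'').
  rewrite /S -[LHS](sum_translate (e t)); apply: eq_bigr => f _; rewrite !evD.
  congr (h (_ + _) * G _ _); rewrite /ev /e /=; ring.
(* This sum is [#|F|] times [S], and [K] has characteristic zero. *)
have: \sum_(t : F) S = 0.
  rewrite (eq_bigr _ (fun t _ => St t)) exchange_big big1 //= => f _.
  rewrite -mulr_suml (_ : \sum_t _ = 0) ?mul0r // -[RHS]h0.
  rewrite [RHS](reindex_inj (h := fun t => ev f x + t * ((x - x') * (x - x'')))) //.
  by apply: (can_inj (g := fun y => (y - ev f x) / ((x - x') * (x - x'')))) => t;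
    field; rewrite !subr_eq0 xx' xx''.
rewrite sumr_const => /eqP; rewrite mulrn_eq0 => /orP[|/eqP //].
by rewrite -leqn0 leqNgt => /negP[]; apply/card_gt0P; exists 0.
Qed.

Lemma sum_ev (phi : F -> K) x : \sum_(f : V) phi (ev f x) = q ^+ 2 * \sum_y phi y.
Proof.
pose s f : V := (f.1, f.2 - f.1.1 * x ^+ 2 - f.1.2 * x).
have s_inj : injective s.
  by move=> [[a b] c] [[a' b'] c'] [-> ->] /addIr/addIr ->.
rewrite (reindex_inj s_inj) /=.
rewrite (eq_bigr (fun f : V => phi f.2)); last first.
  by move=> f _; congr phi; rewrite /ev /=; ring.
rewrite -(pair_big xpredT xpredT (fun _ : F * F => phi)) /= sumr_const.
rewrite -[LHS]mulr_natl expr2 -natrM -card_prod; congr (_%:R * _); exact: eq_card.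
Qed.

(** Expand the power into a sum over tuples of points. Unless all points of a tuple agree, one of
    them occurs exactly once, and [sum_ev_orth] at that point makes the term vanish; the diagonal is
    evaluated by [sum_ev]. *)
Lemma sum_val_cube (h : F -> F -> K) (H := fun f : V => \sum_x h x (ev f x)) :
  (forall x, \sum_y h x y = 0) ->
  [/\ \sum_(f : V) H f = 0,
      \sum_(f : V) H f ^+ 2 = q ^+ 2 * \sum_x \sum_y h x y ^+ 2 &
      \sum_(f : V) H f ^+ 3 = q ^+ 2 * \sum_x \sum_y h x y ^+ 3].
Proof.
move=> h0; split.
- by rewrite exchange_big big1 //= => x _; rewrite sum_ev h0 mulr0.
- under eq_bigr => f _ do rewrite expr2 mulr_suml.
  rewrite exchange_big mulr_sumr; apply: eq_bigr => x _ /=.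
  under eq_bigr => f _ do rewrite mulr_sumr.
  rewrite exchange_big (bigD1 x) //= [X in _ + X]big1 => [|x' x'x].
    by rewrite addr0 (sum_ev (fun y => h x y * h x y)); under [in RHS]eq_bigr do rewrite expr2.
  by apply: (sum_ev_orth (fun y _ => h x' y) (x'' := x')); rewrite // eq_sym.
under eq_bigr => f _ do rewrite exprS mulr_suml.
rewrite exchange_big mulr_sumr; apply: eq_bigr => x _ /=.
under eq_bigr => f _ do rewrite expr2 big_distrlr mulr_sumr /=.
rewrite exchange_big (bigD1 x) //= [X in _ + X]big1 => [|x' x'x].
  rewrite addr0; under eq_bigr => f _ do rewrite mulr_sumr.
  rewrite exchange_big (bigD1 x) //= [X in _ + X]big1 => [|x' x'x].
    by rewrite addr0 (sum_ev (fun y => h x y * (h x y * h x y)));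
      under [in RHS]eq_bigr do rewrite exprS expr2.
  rewrite -[RHS](@sum_ev_orth (h x') (fun y _ => h x y * h x y) x' x x) //.
  by apply: eq_bigr => f _; ring.
under eq_bigr => f _ do rewrite mulr_sumr.
rewrite exchange_big big1 //= => x'' _.
have [->|x''x] := eqVneq x'' x.
  rewrite -[RHS](@sum_ev_orth (h x') (fun y _ => h x y * h x y) x' x x) //.
  by apply: eq_bigr => f _; ring.
rewrite -[RHS](@sum_ev_orth (h x) (fun y z => h x' y * h x'' z) x x' x'') // eq_sym //.
Qed.

Definition autocorr (v : V -> K) (e : V) : K := \sum_(f : V) v f * v (f + e).

Lemma autocorrE v e e' : \sum_(f : V) v (f + e) * v (f + e') = autocorr v (e' - e).
Proof.
rewrite -(sum_translate (- e)); apply: eq_bigr => f _.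
by rewrite addrNK addrAC addrA.
Qed.

Lemma sum_corr (I J : finType) (v : V -> K) (a : I -> V) (b : J -> V) :
  \sum_(f : V) (\sum_i v (f + a i)) * (\sum_j v (f + b j)) =
  \sum_i \sum_j autocorr v (b j - a i).
Proof.
under eq_bigr => f _ do rewrite big_distrlr /=.
rewrite exchange_big; apply: eq_bigr => i _ /=.
by rewrite exchange_big; apply: eq_bigr => j _; rewrite autocorrE.
Qed.
End Correlation.

(** * Tangent pairs in odd characteristic *)

Section Tangent.
Variables (F : finFieldType) (K : realFieldType).
Notation V := (F * F * F)%type.
Notation q := (#|F|%:R : K).

(* The coefficients of [t * (X - r) ^+ 2]. *)
Definition double_root (r t : F) : V := (t, - (r * t) *+ 2, r ^+ 2 * t).

Lemma double_rootD r s t : double_root r (s + t) = double_root r s + double_root r t.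
Proof. by congr ((_, _), _); rewrite /=; ring. Qed.

Lemma double_rootN r t : double_root r (- t) = - double_root r t.
Proof. by congr ((_, _), _); rewrite /=; ring. Qed.

(** An average over translations [b] that every [a i] merely permutes absorbs the average over [a]:
    this is the rule P Q = Q for nested projections, up to normalization. *)
Lemma corr_absorb (I J : finType) (v : V -> K) (a : I -> V) (b : J -> V) (s : I -> J -> J) :
  (forall i, injective (s i)) -> (forall i j, b (s i j) - a i = b j) ->
  \sum_(f : V) (\sum_i v (f + a i)) * (\sum_j v (f + b j)) =
  #|I|%:R * \sum_j autocorr v (b j).
Proof.
move=> s_inj ab; rewrite sum_corr mulr_natl -sumr_const.
apply: eq_bigr => i _; rewrite (reindex_inj (s_inj i)).
by apply: eq_bigr => j _; rewrite ab.
Qed.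

Lemma sum_autocorr v : \sum_(f : V) v f = 0 -> \sum_e autocorr v e = 0 :> K.
Proof.
move=> v0; rewrite exchange_big big1 //= => f _.
rewrite -mulr_sumr (_ : \sum_e _ = 0) ?mulr0 // -[RHS]v0.
by rewrite [RHS](reindex_inj (addrI f)).
Qed.

Lemma double_root_basis (r s s' : F) : 2%:R != 0 :> F -> r != s -> r != s' -> s != s' ->
  injective (fun p : V => double_root r p.1.1 + double_root s p.1.2 + double_root s' p.2).
Proof.
move=> two rs rs' ss'.
have ne x y : x != y -> x - y != 0 :> F by rewrite subr_eq0.
(* The numerator is the polar form of [f] at [(y, z)], which vanishes on the squares of [X - y] and
   [X - z]; the denominator is its value on the square of [X - x]. *)
pose l (x y z : F) (f : V) := (f.2 + (y + z) * f.1.2 / 2%:R + y * z * f.1.1) / ((x - y) * (x - z)).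
apply: (can_inj (g := fun f => (l r s s' f, l s r s' f, l s' r s f))) => -[[a b] c].
by rewrite /l /double_root /=; congr ((_, _), _); field; rewrite ?two ?ne // eq_sym.
Qed.

(* Let Q_r be the orthogonal projection onto functions invariant under translation by the
   [double_root r t]; the Q_r commute, and a product of three distinct ones kills [v]. So for fixed
   r the vectors Q_r Q_s v are orthogonal and Bessel bounds the sum of their squared norms by that
   of Q_r v; hence X = \sum_r Q_r satisfies |X v|^2 <= 2 <v, X v>, and 0 <= |X v - 2 v|^2 gives
   <v, X v> <= 2 |v|^2. Below, [a r = q Q_r v] and [b r s = q^2 Q_r Q_s v]. *)
Lemma double_root_bessel (v : V -> K) : 2%:R != 0 :> F -> \sum_(f : V) v f = 0 ->
  \sum_r \sum_t autocorr v (double_root r t) <= 2%:R * q * autocorr v 0.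
Proof.
move=> two v0.
pose a r f := \sum_t v (f + double_root r t).
pose b r s f := \sum_(p : F * F) v (f + (double_root r p.1 + double_root s p.2)).
pose alpha r := \sum_t autocorr v (double_root r t).
pose beta r s := \sum_(p : F * F) autocorr v (double_root r p.1 + double_root s p.2).
have va r : \sum_f v f * a r f = alpha r.
  by under eq_bigr do rewrite mulr_sumr; rewrite exchange_big.
have aa r : \sum_f a r f * a r f = q * alpha r.
  apply: (@corr_absorb _ _ v _ _ (fun t t' => t' + t)) => [t|t t']; first exact: addIr.
  by rewrite double_rootD addrK.
have aa' r s : \sum_f a r f * a s f = beta r s.
  rewrite sum_corr /beta.
  rewrite -(pair_big xpredT xpredT (fun t t' => autocorr v (double_root r t + double_root s t'))) /=.
  rewrite [RHS](reindex_inj (@oppr_inj F)); apply: eq_bigr => t _; apply: eq_bigr => t' _.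
  by rewrite double_rootN addrC.
have ab r s : \sum_f a r f * b r s f = q * beta r s.
  apply: (@corr_absorb _ _ v _ _ (fun t (p : F * F) => (p.1 + t, p.2))) => [t [x y] [x' y']|t p] /=.
    by case=> /addIr -> ->.
  by rewrite double_rootD addrAC addrK.
have bb r s : \sum_f b r s f * b r s f = q ^+ 2 * beta r s.
  rewrite expr2 -natrM -card_prod.
  apply: (@corr_absorb _ _ v _ _ (fun p p' => (p'.1 + p.1, p'.2 + p.2))) => [[x y] [t u] [t' u']|p p'] /=.
    by case=> /addIr -> /addIr ->.
  by rewrite !double_rootD addrACA addrK.
have bb' r s s' : r != s -> r != s' -> s != s' -> \sum_f b r s f * b r s' f = 0.
  move=> rs rs' ss'; rewrite sum_corr.
  rewrite -(pair_big xpredT xpredT (fun x y => \sum_j autocorr v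
     (double_root r j.1 + double_root s' j.2 - (double_root r x + double_root s y)))) /=.
  apply: big1 => x _; rewrite pair_big /=.
  (* With [x] fixed, the remaining three parameters make the shift run once through all of [V], the
     three squares being a basis; [h] is the change of parameters. *)
  rewrite -[RHS](sum_autocorr v0) [RHS](reindex_inj (double_root_basis two rs rs' ss')) /=.
  pose h (p : V) : F * (F * F) := (- p.1.2, (p.1.1 + x, p.2)).
  have h_inj : injective h by move=> [[? ?] ?] [[? ?] ?] [/oppr_inj -> /addIr -> ->].
  have h_bij : bijective h by apply: inj_card_bij => //; rewrite !card_prod; lia.
  rewrite (reindex h) /=; last exact: onW_bij.
  apply: eq_bigr => -[[t u] w] _; congr autocorr; rewrite /= double_rootN double_rootD.
  by rewrite opprD opprK; congr ((_, _), _); rewrite /=; ring.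
have bessel r : \sum_(s | s != r) beta r s <= q * alpha r.
  have q0 : 0 < q by rewrite ltr0n; apply/card_gt0P; exists 0.
  have: 0 <= \sum_(f : V) (q * a r f - \sum_(s | s != r) b r s f) ^+ 2.
    by apply: sumr_ge0 => f _; apply: sqr_ge0.
  rewrite (_ : \sum_f _ = q ^+ 3 * alpha r - q ^+ 2 * \sum_(s | s != r) beta r s).
    by rewrite exprSr -mulrA -mulrBr pmulr_rge0 ?exprn_gt0 // subr_ge0.
  transitivity (q ^+ 2 * (\sum_f a r f * a r f)
    - 2 * q * (\sum_f a r f * (\sum_(s | s != r) b r s f))
    + \sum_f (\sum_(s | s != r) b r s f) * (\sum_(s | s != r) b r s f)).
    rewrite !mulr_sumr -!sumrB -big_split /=; apply: eq_bigr => f _; ring.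
  have -> : \sum_f a r f * (\sum_(s | s != r) b r s f) = q * \sum_(s | s != r) beta r s.
    under eq_bigr do rewrite mulr_sumr.
    by rewrite exchange_big mulr_sumr; apply: eq_bigr => s _; rewrite ab.
  have -> : \sum_f (\sum_(s | s != r) b r s f) * (\sum_(s | s != r) b r s f)
            = q ^+ 2 * \sum_(s | s != r) beta r s.
    under eq_bigr do rewrite big_distrlr /=.
    rewrite exchange_big mulr_sumr; apply: eq_bigr => s sr /=.
    rewrite exchange_big (bigD1 s) //= bb big1 ?addr0 // => s' /andP[s'r s's].
    by apply: bb'; rewrite // eq_sym.
  by rewrite aa; ring.
have: 0 <= \sum_(f : V) (\sum_r a r f - 2%:R * q * v f) ^+ 2.
  by apply: sumr_ge0 => f _; apply: sqr_ge0.
rewrite (_ : \sum_f _ = \sum_r (q * alpha r + \sum_(s | s != r) beta r s)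
   - 4%:R * q * \sum_r alpha r + 4%:R * q ^+ 2 * autocorr v 0).
  have: \sum_r (q * alpha r + \sum_(s | s != r) beta r s) <= 2%:R * q * \sum_r alpha r.
    rewrite mulr_sumr; apply: ler_sum => r _; have := bessel r; lra.
  have q0 : 0 < q by rewrite ltr0n; apply/card_gt0P; exists 0.
  move=> H1 H2; rewrite -(ler_pM2l q0) -/(\sum_r alpha r); nra.
transitivity (\sum_f (\sum_r a r f) * (\sum_r a r f)
    - 4%:R * q * (\sum_f v f * (\sum_r a r f)) + 4%:R * q ^+ 2 * \sum_f v f * v f).
  rewrite !mulr_sumr -!sumrB -big_split /=; apply: eq_bigr => f _; ring.
congr (_ - _ * _ + _ * _).
- under eq_bigr do rewrite big_distrlr /=.
  rewrite exchange_big; apply: eq_bigr => r _ /=.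
  rewrite exchange_big (bigD1 r) //= aa; congr (_ + _).
  by apply: eq_bigr => s _; rewrite aa'.
- under eq_bigr do rewrite mulr_sumr.
  by rewrite exchange_big; apply: eq_bigr => r _; rewrite va.
by apply: eq_bigr => f _; rewrite addr0.
Qed.

Definition shift_pairs (U : {set V}) (e : V) : nat := #|[set f in U | f + e \in U]|.

(** Apply [double_root_bessel] to the indicator of [U] minus its density [N / q ^ 3]: each
    autocorrelation is then a pair count minus [N ^ 2 / q ^ 3], and the shifts with [t = 0]
    contribute [q * N]. *)
Lemma tangent_pairs (U : {set V}) : 2%:R != 0 :> F ->
  (\sum_r \sum_(t | t != 0%R) shift_pairs U (double_root r t))%:R
    <= q * #|U|%:R + #|U|%:R ^+ 2 / q - 2%:R * #|U|%:R ^+ 2 / q ^+ 2.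
Proof.
move=> two; pose N : K := #|U|%:R; pose u f : K := (f \in U)%:R.
pose v f := u f - N / q ^+ 3.
have q0 : q != 0 by rewrite pnatr_eq0 -lt0n; apply/card_gt0P; exists 0.
have sc (c : K) : \sum_(f : V) c = q ^+ 3 * c.
  rewrite sumr_const -[LHS]mulr_natl; congr (_ * _).
  by rewrite (eq_card (B := {: V})) // !card_prod !natrM; ring.
have su : \sum_f u f = N.
  by rewrite /N -sum1_card natr_sum [RHS]big_mkcond; apply: eq_bigr => f _; rewrite /u; case: (f \in U).
have v0 : \sum_f v f = 0 by rewrite sumrB su sc; field.
have cE e : autocorr v e = (shift_pairs U e)%:R - N ^+ 2 / q ^+ 3.
  transitivity (\sum_f (u f * u (f + e) - N / q ^+ 3 * u f - N / q ^+ 3 * u (f + e) + (N / q ^+ 3) ^+ 2)).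
    by apply: eq_bigr => f _; rewrite /v; ring.
  rewrite big_split !sumrB /= -!mulr_sumr sc (sum_translate e) su.
  rewrite (_ : \sum_f u f * u (f + e) = (shift_pairs U e)%:R); first by field.
  rewrite /shift_pairs -sum1_card natr_sum [RHS]big_mkcond; apply: eq_bigr => f _.
  by rewrite /u inE; case: (f \in U); case: (_ \in U); rewrite ?mulr1 ?mulr0.
have := double_root_bessel two v0.
have -> : autocorr v 0 = N - N ^+ 2 / q ^+ 3.
  by rewrite cE; congr (_%:R - _); apply: eq_card => f; rewrite inE addr0 andbb.
have -> : \sum_r \sum_t autocorr v (double_root r t) = q * N +
  (\sum_r \sum_(t | t != 0%R) shift_pairs U (double_root r t))%:R - N ^+ 2 / q.
  transitivity (\sum_(r : F) (N - N ^+ 2 / q ^+ 2 +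
    (\sum_(t | t != 0%R) shift_pairs U (double_root r t))%:R)).
    apply: eq_bigr => r _; rewrite (eq_bigr _ (fun t _ => cE (double_root r t))).
    rewrite sumrB sumr_const (bigD1 0) //= natr_sum.
    rewrite (_ : shift_pairs U _ = #|U|); last first.
      apply: eq_card => f; rewrite inE (_ : double_root r 0 = 0) ?addr0 ?andbb //.
      by congr ((_, _), _); rewrite /=; ring.
    rewrite -mulr_natl; field=> //.
  rewrite big_split /= natr_sum sumr_const -mulr_natl; field=> //.
rewrite (_ : 2 * q * _ = 2 * q * N - 2 * N ^+ 2 / q ^+ 2); last by field.
by rewrite -/N; lra.
Qed.
End Tangent.

(** * Intersections *)

Section Meets.
Variables (F : finFieldType).
Notation V := (F * F * F)%type.
Implicit Types (f g : V) (x y : F).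

Lemma ev_interp_inj x1 x2 x3 : x1 != x2 -> x1 != x3 -> x2 != x3 ->
  injective (fun f : V => (ev f x1, ev f x2, ev f x3)).
Proof.
move=> n12 n13 n23.
have ne x y : x != y -> x - y != 0 :> F by rewrite subr_eq0.
(* Newton interpolation: [d2] is the second divided difference, hence the leading coefficient, and
   [d1] is the linear one. *)
pose d2 (u v w : F) := ((u - v) / (x1 - x2) - (u - w) / (x1 - x3)) / (x2 - x3).
pose d1 (u v w : F) := (u - v) / (x1 - x2) - d2 u v w * (x1 + x2).
apply: (can_inj (g := fun p : V => let: (u, v, w) := p in
  (d2 u v w, d1 u v w, u - d2 u v w * x1 ^+ 2 - d1 u v w * x1))) => -[[a b] c].
by rewrite /d1 /d2 /ev /=; congr ((_, _), _); field; rewrite ?ne.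
Qed.

Lemma ev_interp x1 x2 x3 y1 y2 y3 : x1 != x2 -> x1 != x3 -> x2 != x3 ->
  exists f : V, [/\ ev f x1 = y1, ev f x2 = y2 & ev f x3 = y3].
Proof.
move=> n12 n13 n23; have [g gK Kg] := injF_bij (ev_interp_inj n12 n13 n23).
by exists (g (y1, y2, y3)); case: (Kg (y1, y2, y3)).
Qed.

Definition meets f g := #|[set x | ev f x == ev g x]|.

Lemma meetsE f g : meets f g = (\sum_x (ev f x == ev g x))%N.
Proof. by rewrite /meets -sum1dep_card big_mkcond. Qed.

Lemma meets_le2 f g : f != g -> (meets f g <= 2)%N.
Proof.
apply: contraNT; rewrite -ltnNge => /card_gt2P[x1 [x2 [x3 [[]]]]].
rewrite !inE => /eqP e1 /eqP e2 /eqP e3 [n12 n23 n31].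
by apply/eqP/(ev_interp_inj n12 _ n23); rewrite ?e1 ?e2 ?e3 // eq_sym.
Qed.

(** The difference [g - f] is a genuine quadratic with a root [r] in the field; by Vieta its other
    root [r'] is in the field too, so a single meeting point forces [r' = r]. This works in every
    characteristic. *)
Lemma tangentP f g : f.1.1 != g.1.1 -> meets f g = 1%N ->
  exists2 t, t != 0 & exists r, g = f + double_root r t.
Proof.
case: f g => [[a b] c] [[a' b'] c'] /= aa' /eqP/cards1P[r er].
have A0 : a' - a != 0 by rewrite subr_eq0 eq_sym.
pose r' := - (b' - b) / (a' - a) - r.
have: r \in [set x | ev (a, b, c) x == ev (a', b', c') x] by rewrite er inE.
rewrite inE /ev /= => /eqP rr.
have cc : c' = a * r ^+ 2 + b * r + c - a' * r ^+ 2 - b' * r by rewrite rr; ring.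
have: r' \in [set x | ev (a, b, c) x == ev (a', b', c') x].
  by rewrite inE /ev /= cc; apply/eqP; rewrite /r'; field.
rewrite er inE => /eqP r'r; exists (a' - a) => //; exists r.
have bb : b' = b - (r * (a' - a)) *+ 2.
  have : (b' - b) = - (r' + r) * (a' - a) by rewrite /r'; field.
  by rewrite r'r => h; rewrite -[b'](subrK b) h; ring.
by rewrite /double_root; congr ((_, _), _); rewrite /= ?cc ?bb; ring.
Qed.

(* For k <= 2, [2 * (0 < k) = 2 * k - k * (k - 1)], so the polynomials through
   [(x0, y0)] that meet [f] are counted by the first two factorial moments of [meets]. *)
Lemma meeting_through f x0 y0 : ev f x0 != y0 ->
  (2 * #|[set g : V | (ev g x0 == y0) && (0 < meets g f)]| + (#|F|.-1 * #|F|.-2)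
     <= 2 * (#|F| * #|F|.-1))%N.
Proof.
move=> fP; pose G := [set g : V | ev g x0 == y0].
have k2 g : g \in G -> (meets g f <= 2)%N.
  by rewrite inE => /eqP gP; apply: meets_le2; apply: contraNneq fP => <-; rewrite gP.
have cF x : #|[pred y | y != x]| = #|F|.-1 by rewrite (cardC1 x).
(* For each ordered pair of distinct abscissas other than [x0], interpolation gives a polynomial
   through [(x0, y0)] that agrees with [f] at both. *)
have lo : (#|F|.-1 * #|F|.-2 <= \sum_(g in G) meets g f * (meets g f).-1)%N.
  apply: (@leq_trans (\sum_(g in G) \sum_(x | x != x0) \sum_(x' | (x' != x0) && (x' != x))
      ((ev g x == ev f x) && (ev g x' == ev f x')))).
    rewrite exchange_big /= -[X in (X * _)%N](cF x0) -sum_nat_const; apply: leq_sum => x; rewrite inE => xx0.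
    rewrite exchange_big /=.
    have <- : #|[pred x' | (x' != x0) && (x' != x)]| = #|F|.-2.
      rewrite -(cardC (pred2 x0 x)) card2 eq_sym xx0.
      by apply: eq_card => z; rewrite !inE negb_or.
    rewrite -sum1_card; apply: leq_sum => x' /andP[x'x0 x'x].
    have [|||g [g0 gx gx']] := @ev_interp x0 x x' y0 (ev f x) (ev f x'); rewrite 1?eq_sym //.
    rewrite (bigD1 g) ?inE ?g0 //= gx gx' !eqxx //.
  apply: leq_sum => g gG; set R := [set x | ev g x == ev f x].
  have -> : (meets g f * (meets g f).-1 = \sum_(x in R) \sum_(x' in R :\ x) 1)%N.
    rewrite -sum_nat_const; apply: eq_bigr => x xR.
    by rewrite sum1_card cardsDS ?sub1set // cards1 subn1.
  rewrite big_mkcond [leqRHS]big_mkcond; apply: leq_sum => x _; rewrite inE.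
  case: (x != x0) => //; case: eqP => _ /=; last by rewrite big1.
  rewrite big_mkcond [leqRHS]big_mkcond; apply: leq_sum => x' _; rewrite !inE.
  by case: (x' != x0); case: (x' != x); case: eqP.
(* For each [x] other than [x0], a polynomial through two prescribed points is determined by its
   leading coefficient, so there are at most [#|F|] of them. *)
have hi : (\sum_(g in G) meets g f <= #|F| * #|F|.-1)%N.
  under eq_bigr => g _ do rewrite meetsE.
  rewrite exchange_big (bigD1 x0) //= big1 => [|g]; last first.
    by rewrite inE => /eqP ->; rewrite eq_sym (negbTE fP).
  rewrite add0n mulnC -[X in (X * _)%N](cF x0) -sum_nat_const; apply: leq_sum => x xx0.
  rewrite -big_mkcondr sum1dep_card.
  rewrite -(card_in_imset (f := fun g : V => g.1.1)) ?max_card // => g h.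
  rewrite !inE => /andP[/eqP g0 /eqP gx] /andP[/eqP h0 /eqP hx] gh.
  have {g0 h0} e0 := etrans g0 (esym h0); have {gx hx} ex := etrans gx (esym hx).
  case: g h gh e0 ex => [[a b] c] [[a' b'] c']; rewrite /ev /= => <- e0 ex.
  have bb : b = b'.
    apply: (@mulIf _ (x - x0)); first by rewrite subr_eq0.
    transitivity ((a * x ^+ 2 + b * x + c) - (a * x0 ^+ 2 + b * x0 + c) - a * (x ^+ 2 - x0 ^+ 2)).
      by ring.
    by rewrite e0 ex; ring.
  by move: e0; rewrite bb => /addrI ->.
have -> : #|[set g : V | (ev g x0 == y0) && (0 < meets g f)%N]| = (\sum_(g in G) (0 < meets g f)%N)%N.
  by rewrite -big_mkcondr sum1dep_card; apply: eq_card => g; rewrite !inE.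
have : (2 * (\sum_(g in G) (0 < meets g f)%N) + \sum_(g in G) meets g f * (meets g f).-1
  <= 2 * \sum_(g in G) meets g f)%N.
  rewrite !big_distrr -big_split /=; apply: leq_sum => g /k2.
  by case: (meets g f) => [|[|[|]]].
lia.
Qed.
End Meets.

(** * Coincident coefficients and tangencies inside a pairwise meeting family *)

Section Family.
Variables (F : finFieldType) (K : realFieldType).
Notation V := (F * F * F)%type.
Notation q := (#|F|%:R : K).
Implicit Types (f g : V) (x y : F) (U : {set V}).

Definition coincidence_pairs U (phi : V -> F) : nat :=
  \sum_(f in U) \sum_(g in U | g != f) (phi f == phi g).

Definition fibres_bounded U (phi : V -> F) : Prop :=
  forall y, (#|[set f in U | phi f == y]| <= #|F|)%N.

Lemma coincidence_pairsE U phi :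
  (coincidence_pairs U phi + #|U| = \sum_y #|[set f in U | phi f == y]| ^ 2)%N.
Proof.
transitivity (\sum_(f in U) #|[set g in U | phi g == phi f]|)%N.
  rewrite /coincidence_pairs -sum1_card -big_split /=; apply: eq_bigr => f fU.
  rewrite -sum1dep_card [RHS]big_mkcondr [RHS](bigD1 f fU) eqxx [LHS]addnC; congr (_ + _)%N.
  by apply: eq_bigr => g _; rewrite eq_sym; case: eqP.
rewrite (partition_big phi xpredT) //=; apply: eq_bigr => y _.
rewrite expnS expn1 -[X in (X * _)%N]sum1dep_card big_distrl /=.
by apply: eq_bigr => f /andP[_ /eqP ->]; rewrite mul1n.
Qed.

(** The squares of the fibre sizes sum to at most [q] times the sum of the sizes; the diagonal
    accounts for the [- 1]. *)
Lemma coincidence_pairs_le U phi : fibres_bounded U phi ->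
  (coincidence_pairs U phi)%:R <= (q - 1) * #|U|%:R.
Proof.
move=> h; have := coincidence_pairsE U phi.
have e : #|U| = (\sum_y #|[set f in U | phi f == y]|)%N.
  rewrite -sum1_card (partition_big phi xpredT) //=.
  by apply: eq_bigr => y _; rewrite sum1dep_card.
have : (\sum_y #|[set f in U | phi f == y]| ^ 2 <= #|F| * #|U|)%N.
  by rewrite e big_distrr; apply: leq_sum => y _; rewrite expnS expn1 leq_mul2r h orbT.
move=> le eq; have : (coincidence_pairs U phi + #|U| <= #|F| * #|U|)%N by rewrite eq.
by rewrite -(ler_nat K) natrD natrM; lra.
Qed.

(* With d = q^2 - #|U|, each fibre has size between q - d and q. This refinement of
   [coincidence_pairs_le] is only needed for q = 4. *)
Lemma coincidence_pairs_le_dense U phi : fibres_bounded U phi ->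
  (coincidence_pairs U phi)%:R
    <= (q - 1) * #|U|%:R - (q - (q ^+ 2 - #|U|%:R)) * (q ^+ 2 - #|U|%:R).
Proof.
move=> h; have := coincidence_pairsE U phi.
pose n y := #|[set f in U | phi f == y]|.
have e : #|U|%:R = \sum_y (n y)%:R :> K.
  rewrite -natr_sum -sum1_card (partition_big phi xpredT) //=; congr (_%:R).
  by apply: eq_bigr => y _; rewrite sum1dep_card.
move/(congr1 (fun k => k%:R : K)); rewrite natrD natr_sum => E.
have lo y : q - (q ^+ 2 - #|U|%:R) <= (n y)%:R.
  have : #|U|%:R <= (n y)%:R + \sum_(z | z != y) q.
    by rewrite e (bigD1 y) //= lerD2l; apply: ler_sum => z _; rewrite ler_nat h.
  have -> : \sum_(z | z != y) q = q ^+ 2 - q.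
    rewrite sumr_const (cardC1 y) -[LHS]mulr_natr -subn1 natrB; last by apply/card_gt0P; exists 0.
    by rewrite mulrBr mulr1 expr2.
  by lra.
(* Each fibre size lies between two known bounds, so the product of its distances to them is
   nonnegative; summing bounds the squares from above. *)
have : 0 <= \sum_y (q - (n y)%:R) * ((n y)%:R - (q - (q ^+ 2 - #|U|%:R))).
  by apply: sumr_ge0 => y _; rewrite mulr_ge0 ?subr_ge0 ?lo ?ler_nat ?h.
set D := q ^+ 2 - #|U|%:R.
rewrite (_ : \sum_y _ = (2 * q - D) * \sum_y (n y)%:R - \sum_y (n y ^ 2)%:R - \sum_(y : F) (q * (q - D))).
  by rewrite sumr_const -mulr_natl -e /D -E; nra.
by rewrite mulr_sumr -!sumrB; apply: eq_bigr => y _; rewrite natrX; ring.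
Qed.

Definition pairwise_meeting U : Prop := {in U &, forall f g, (0 < meets f g)%N}.

(** Equal leading and linear coefficients leave a constant difference, which has a zero only if it
    is zero. *)
Lemma pairwise_meeting_ab U : pairwise_meeting U -> {in U &, forall f g, f.1 = g.1 -> f = g}.
Proof.
move=> h [[a b] c] [[a' b'] c'] fU gU /= [ea eb]; subst a' b'; have := h _ _ fU gU.
by case/card_gt0P => x; rewrite inE /ev /= => /eqP e; rewrite (addrI _ e).
Qed.

Lemma fibres_bounded_quad U : pairwise_meeting U -> fibres_bounded U (fun f => f.1.1).
Proof.
move=> h y; rewrite -(card_in_imset (f := fun f : V => f.1.2)) ?max_card // => f g.
rewrite !inE => /andP[fU /eqP fy] /andP[gU /eqP gy] e.
by apply: (pairwise_meeting_ab h) => //; rewrite [f.1]surjective_pairing [g.1]surjective_pairing fy gy e.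
Qed.

(** This serves characteristic two, where tangent members share their linear coefficient. *)
Lemma fibres_bounded_lin U : pairwise_meeting U -> fibres_bounded U (fun f => f.1.2).
Proof.
move=> h y; rewrite -(card_in_imset (f := fun f : V => f.1.1)) ?max_card // => f g.
rewrite !inE => /andP[fU /eqP fy] /andP[gU /eqP gy] e.
by apply: (pairwise_meeting_ab h) => //; rewrite [f.1]surjective_pairing [g.1]surjective_pairing fy gy e.
Qed.

Lemma card_pairwise_meeting U : pairwise_meeting U -> (#|U| <= #|F| ^ 2)%N.
Proof.
move=> h; rewrite -(card_in_imset (f := fun f : V => f.1)); last exact: pairwise_meeting_ab.
by rewrite (leq_trans (max_card _)) // card_prod.
Qed.

Definition total_meets U : nat := \sum_(f in U) \sum_(g in U) meets f g.

Definition tangent f g := (f.1.1 != g.1.1) && (meets f g == 1%N).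

(** The diagonal gives [q] per member. An ordered pair of distinct members gives at least two
    meetings, or at least one if the leading coefficients agree or the pair is tangent. *)
Lemma total_meets_ge U : pairwise_meeting U ->
  q * #|U|%:R + 2 * #|U|%:R * (#|U|%:R - 1) - (coincidence_pairs U (fun f => f.1.1))%:R
   - (\sum_(f in U) \sum_(g in U | g != f) tangent f g)%:R <= (total_meets U)%:R :> K.
Proof.
move=> h.
suff : (#|F| * #|U| + 2 * #|U| * #|U| <= total_meets U + coincidence_pairs U (fun f => f.1.1)
   + (\sum_(f in U) \sum_(g in U | g != f) tangent f g) + 2 * #|U|)%N.
  by rewrite -(ler_nat K) !natrD !natrM; lra.
rewrite [(#|F| * _)%N]mulnC -!mulnA [(2 * _)%N]mulnC -mulnA [(2 * #|U|)%N]mulnC.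
rewrite -!sum_nat_const -!big_split /=.
apply: leq_sum => f fU.
have mff : meets f f = #|F| by rewrite /meets -cardsT; apply: eq_card => x; rewrite !inE eqxx.
rewrite [\sum_(g in U) meets f g](bigD1 f fU) mff /= -!addnA leq_add2l.
rewrite [(\sum_(_ in U) 2)%N](bigD1 f fU) /= addnC !addnA leq_add2r -!big_split /=.
apply: leq_sum => g /andP[gU gf].
have := h _ _ fU gU; rewrite /tangent; case: eqP => //= _; last first.
  by case: (meets f g) => [|[|]].
by case: (meets f g) => [|[|]].
Qed.

(** By [tangentP], every tangent pair arises from a shift by some [double_root r t] with [t]
    nonzero, so [tangent_pairs] bounds their number. *)
Lemma tangent_pairs_odd U : 2%:R != 0 :> F ->
  (\sum_(f in U) \sum_(g in U | g != f) tangent f g)%:R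
    <= q * #|U|%:R + #|U|%:R ^+ 2 / q - 2%:R * #|U|%:R ^+ 2 / q ^+ 2.
Proof.
move=> two; apply: le_trans (tangent_pairs K U two); rewrite ler_nat.
have -> : (\sum_r \sum_(t | t != 0%R) shift_pairs U (double_root r t) =
  \sum_(f in U) \sum_r \sum_(t : F | t != 0%R) ((f + double_root r t)%R \in U))%N.
  rewrite [RHS]exchange_big; apply: eq_bigr => r _.
  rewrite [RHS]exchange_big; apply: eq_bigr => t _.
  by rewrite /shift_pairs -sum1dep_card big_mkcondr /=; apply: eq_bigr => f _; case: (_ \in U).
apply: leq_sum => f fU.
apply: (@leq_trans (\sum_(g in U) \sum_r \sum_(t : F | t != 0%R) (g == (f + double_root r t)%R))%N).
  rewrite big_mkcondr; apply: leq_sum => g gU; case: (g != f) => //.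
  rewrite /tangent; case: andP => // -[fg /eqP m1].
  have [t t0 [r ->]] := tangentP fg m1.
  by rewrite (bigD1 r) //= (bigD1 t) //= eqxx.
rewrite exchange_big; apply: leq_sum => r _; rewrite exchange_big; apply: leq_sum => t _.
case: (boolP ((f + double_root r t)%R \in U)) => [hU|hU]; last first.
  by rewrite big1 // => g gU; case: eqP hU => // <-; rewrite gU.
by rewrite (bigD1 _ hU) eqxx /= big1 // => g /andP[_ /negbTE ->].
Qed.

(** In characteristic two [double_root r t] has no linear term. *)
Lemma tangent_pairs_even U : 2%:R = 0 :> F ->
  (\sum_(f in U) \sum_(g in U | g != f) tangent f g <= coincidence_pairs U (fun f => f.1.2))%N.
Proof.
move=> two; apply: leq_sum => f fU; apply: leq_sum => g _.
rewrite /tangent; case: andP => // -[fg /eqP m1].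
have [t t0 [r ->]] := tangentP fg m1.
by rewrite /= -mulr_natr two mulr0 addr0 eqxx.
Qed.

End Family.

(** * Numerical estimates *)

(* The difference of the two sides of [cubic_moment] when the maximal point weight is
   [(q ^+ 2 + q) / 2 - 1 - N / q]. *)
Definition excess (R : realFieldType) (q N A : R) : R :=
  (A + N) * (A + q) ^+ 2 - (q ^+ 2 * A * ((q ^+ 2 + q) / 2 - 1 - N / q + N + 2 * q) + q ^+ 5).

(** The scaling is [t = 1 / q], [n = N / q ^ 2], [a = A / q ^ 2]. *)
Lemma excess_normalized (R : realFieldType) (t n a : R) : t != 0 ->
  excess t^-1 (n / t ^+ 2) (a / t ^+ 2) * t ^+ 6 =
  a * ((a + n) * (a + 2 * t) - 1 / 2 - n - (5 / 2 - n) * t + t ^+ 2) + (a + n) * t ^+ 2 - t.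
Proof. by move=> t0; rewrite /excess; field. Qed.

(** With [B] the bracket of the last hypothesis, the normalized excess is [a * B + n * t ^ 2 - t],
    so the outer factor [a] can be replaced by a constant [xi] below it. *)
Lemma excess_gt0 (R : realFieldType) (xi t n a : R) : 0 < t -> 0 < n -> 0 < xi -> xi <= a ->
  t <= xi * ((a + n) * (a + 2 * t) - 1 / 2 - n - (5 / 2 - n) * t + 2 * t ^+ 2) ->
  0 < excess t^-1 (n / t ^+ 2) (a / t ^+ 2).
Proof.
move=> t0 n0 xi0 xia h; rewrite -(pmulr_lgt0 _ (exprn_gt0 6 t0)) excess_normalized ?lt0r_neq0 //.
set B := (X in xi * X) in h.
have nt : 0 < n * t ^+ 2 by rewrite mulr_gt0 ?exprn_gt0.
have B0 : 0 <= B by rewrite -(pmulr_rge0 _ xi0); lra.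
have : xi * B <= a * B by rewrite ler_wpM2r.
by rewrite /B in h *; lra.
Qed.


Lemma excess_odd_gt0 (R : realFieldType) (t n a : R) : 0 < t <= 1 / 11 -> 25 / 26 <= n ->
  n - (1 + n) * t + (2 * n - 1) * t ^+ 2 <= a -> 0 < excess t^-1 (n / t ^+ 2) (a / t ^+ 2).
Proof.
move=> /andP[t0 t11] hn ha; have n0 : 0 < n by lra.
have t2 : 0 < t ^+ 2 by rewrite exprn_gt0.
have tt : t ^+ 2 <= t / 11 by rewrite expr2; nra.
have nt : 25 / 26 * (1 - t) <= n * (1 - t) by rewrite ler_wpM2r //; lra.
have nt2 : 25 / 26 * t ^+ 2 <= n * t ^+ 2 by rewrite ler_wpM2r //; lra.
(* The lower bound on [a] is taken at [n = 25 / 26], where [2 * n - 1] is [12 / 13]. *)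
have P2 : 25 / 26 * (1 - t) + t + 12 / 13 * t ^+ 2 <= a + 2 * t by lra.
have P1 : 25 / 26 * (2 - t) - t + 12 / 13 * t ^+ 2 + (n - 25 / 26) <= a + n by lra.
have P0 : (25 / 26 * (2 - t) - t + 12 / 13 * t ^+ 2 + (n - 25 / 26)) *
    (25 / 26 * (1 - t) + t + 12 / 13 * t ^+ 2)
   <= (a + n) * (a + 2 * t).
  by apply: ler_pM => //; lra.
(* [79 / 100] is just below the lower bound on [a] at [t = 1 / 11], [n = 25 / 26]. *)
apply: (@excess_gt0 R (79 / 100)) => //; [lra | nra | nra].
Qed.

Lemma excess_even_gt0 (R : realFieldType) (t n a : R) : 0 < t <= 1 / 8 -> 15 / 16 <= n ->
  n - t <= a -> 0 < excess t^-1 (n / t ^+ 2) (a / t ^+ 2).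
Proof.
move=> /andP[t0 t8] hn ha; have n0 : 0 < n by lra.
have P0 : (2 * n - t) * (n + t) <= (a + n) * (a + 2 * t).
  by apply: ler_pM; lra.
have nt : 15 / 16 * t <= n * t by rewrite ler_wpM2r //; lra.
have n2 : (15 / 16) ^+ 2 + 15 / 8 * (n - 15 / 16) <= n ^+ 2 by nra.
(* Here [a >= 15 / 16 - 1 / 8 = 13 / 16], which exceeds [3 / 4]. *)
apply: (@excess_gt0 R (3 / 4)) => //; [lra | lra | nra].
Qed.

Lemma excess_inv (R : realFieldType) (q N A : R) : q != 0 ->
  excess q^-1^-1 (N / q ^+ 2 / q^-1 ^+ 2) (A / q ^+ 2 / q^-1 ^+ 2) = excess q N A.
Proof. by move=> q0; rewrite exprVn !invrK !divfK ?expf_neq0. Qed.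

Lemma excess_odd (R : realFieldType) (q N A : R) : 11 <= q ->
  26 * q ^+ 2 <= q ^+ 2 + 26 * N -> N - 1 - q - N / q + 2 * N / q ^+ 2 <= A -> 0 < excess q N A.
Proof.
move=> q11 hN hA; have q0 : 0 < q by lra.
have q20 : 0 < q ^+ 2 by rewrite exprn_gt0.
rewrite -excess_inv ?lt0r_neq0 //; apply: excess_odd_gt0.
- by rewrite invr_gt0 q0 /= div1r lef_pV2 // posrE.
- by rewrite ler_pdivlMr //; lra.
rewrite ler_pdivlMr //; apply: le_trans hA; rewrite le_eqVlt; apply/orP; left; apply/eqP.
by field; exact: lt0r_neq0.
Qed.

Lemma excess_even (R : realFieldType) (q N A : R) : 8 <= q ->
  16 * q ^+ 2 <= q ^+ 2 + 16 * N -> N - q <= A -> 0 < excess q N A.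
Proof.
move=> q8 hN hA; have q0 : 0 < q by lra.
have q20 : 0 < q ^+ 2 by rewrite exprn_gt0.
rewrite -excess_inv ?lt0r_neq0 //; apply: excess_even_gt0.
- by rewrite invr_gt0 q0 /= div1r lef_pV2 // posrE.
- by rewrite ler_pdivlMr //; lra.
rewrite ler_pdivlMr //; apply: le_trans hA; rewrite le_eqVlt; apply/orP; left; apply/eqP.
by field; exact: lt0r_neq0.
Qed.

(** The fraction comes from using [coincidence_pairs_le_dense] for two coefficients; at [N = 15] the
    bound [N - 4] alone would not give positivity. *)
Lemma excess4_gt0 (R : realFieldType) (N A : R) :
  N - 4 + 2 * (4 - (16 - N)) * (16 - N) / N <= A -> N = 15 \/ N = 16 -> 0 < excess 4 N A.
Proof.
rewrite /excess => hA [] e; move: hA; rewrite e => hA.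
  have : 57 / 5 <= A by lra.
  move=> h; nra.
have : 12 <= A by lra.
move=> h; nra.
Qed.

(** * The common point *)

Section Main.
Variables (F : finFieldType) (K : realFieldType).
Notation V := (F * F * F)%type.
Notation q := (#|F|%:R : K).
Implicit Types (f g : V) (x y : F) (U : {set V}).

Definition point_degree U x y : nat := #|[set f in U | ev f x == y]|.

Lemma sum_point_degree U f : (\sum_x point_degree U x (ev f x) = \sum_(g in U) meets f g)%N.
Proof.
under [RHS]eq_bigr do rewrite meetsE.
rewrite exchange_big; apply: eq_bigr => x _.
rewrite /point_degree -sum1dep_card big_mkcondr; apply: eq_bigr => g _.
by rewrite eq_sym; case: eqP.
Qed.

Lemma sum_point_degree_weighted U (h : F -> F -> K) :
  \sum_x \sum_y (point_degree U x y)%:R * h x y = \sum_(f in U) \sum_x h x (ev f x).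
Proof.
rewrite [RHS]exchange_big; apply: eq_bigr => x _.
rewrite [RHS](partition_big (fun f => ev f x) xpredT) //=; apply: eq_bigr => y _.
rewrite (eq_bigr (fun=> h x y)) => [|f /andP[_ /eqP ->]//].
by rewrite big_const iter_addr_0 mulr_natl; congr (_ *+ _); apply: eq_card => f; rewrite !inE.
Qed.

Lemma card_field_gt0 : 0 < q.
Proof. by rewrite ltr0n; apply/card_gt0P; exists 0. Qed.

(* Sum p(W) = (W + N)(W + q)^2 over all polynomials: it is nonnegative everywhere, and on U it is
   bounded below by its tangent line at the mean A of W. The shift by q, rather than 0, is what
   makes the estimate strong enough for q = 4 and q = 11. *)
Lemma cubic_moment U (M : K) (N := #|U|%:R : K) (A := (total_meets U)%:R / N - N) :
  (0 < #|U|)%N -> (forall x y, (point_degree U x y)%:R - N / q <= M) ->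
  (A + N) * (A + q) ^+ 2 <= q ^+ 2 * A * (M + N + 2 * q) + q ^+ 5.
Proof.
move=> U0 hM; have N0 : 0 < N by rewrite ltr0n.
have q0 := card_field_gt0; have qn0 := lt0r_neq0 q0; have Nn0 := lt0r_neq0 N0.
pose w x y := (point_degree U x y)%:R - N / q.
have degN x : \sum_y (point_degree U x y)%:R = N.
  rewrite -natr_sum /N -[in RHS]sum1_card (partition_big (fun f => ev f x) xpredT) //=.
  by congr (_%:R); apply: eq_bigr => y _; rewrite sum1dep_card.
have w0 x : \sum_y w x y = 0.
  by rewrite sumrB degN sumr_const -[X in _ - X]mulr_natr; field.
have [H1 H2 H3] := sum_val_cube w0.
set H := fun f : V => \sum_x w x (ev f x) in H1 H2 H3.
have HN f : H f + N = (\sum_(g in U) meets f g)%:R.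
  rewrite -sum_point_degree natr_sum /H sumrB sumr_const -[X in _ - X + _]mulr_natr.
  by field.
set S2 := \sum_x \sum_y w x y ^+ 2 in H2.
(* The weights on a vertical line sum to zero, so multiplying [w] by the degree or by [w] itself
   gives the same total. *)
have SU : \sum_(f in U) H f = S2.
  rewrite -sum_point_degree_weighted; apply: eq_bigr => x _.
  transitivity (\sum_y (w x y ^+ 2 + N / q * w x y)).
    by apply: eq_bigr => y _; rewrite /w; ring.
  by rewrite big_split /= -mulr_sumr w0 mulr0 addr0.
have S2A : S2 = N * A.
  rewrite -SU (eq_bigr (fun f => (\sum_(g in U) meets f g)%:R - N)) => [|f _]; last by rewrite -HN addrK.
  rewrite sumrB sumr_const -natr_sum -[(_ *+ _ : K)]mulr_natr -/N /A.
  by rewrite -/(total_meets U); field.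
have A0 : 0 <= A.
  rewrite -(pmulr_rge0 _ N0) -S2A; apply: sumr_ge0 => x _; apply: sumr_ge0 => y _; exact: sqr_ge0.
have S3 : \sum_x \sum_y w x y ^+ 3 <= M * S2.
  rewrite mulr_sumr; apply: ler_sum => x _; rewrite mulr_sumr; apply: ler_sum => y _.
  by rewrite exprS ler_wpM2r ?sqr_ge0 // hM.
pose p z := (z + N) * (z + q) ^+ 2 : K.
have pH0 f : 0 <= p (H f) by rewrite mulr_ge0 ?sqr_ge0 // HN.
have pT z : 0 <= z + N -> p A + ((A + q) ^+ 2 + 2 * (A + N) * (A + q)) * (z - A) <= p z.
  move=> zN; rewrite -subr_ge0.
  have -> : p z - (p A + ((A + q) ^+ 2 + 2 * (A + N) * (A + q)) * (z - A))
    = (z - A) ^+ 2 * ((z + N) + 2 * A + 2 * q) by rewrite /p; ring.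
  by rewrite mulr_ge0 ?sqr_ge0 //; lra.
have lo : N * p A <= \sum_f p (H f).
  apply: (@le_trans _ _ (\sum_(f in U) p (H f))); last first.
    rewrite [leLHS]big_mkcond; apply: ler_sum => f _; case: ifP => // _.
  apply: (@le_trans _ _ (\sum_(f in U) (p A + ((A + q) ^+ 2 + 2 * (A + N) * (A + q)) * (H f - A)))).
    (* The linear terms cancel because [A] is the mean of [H] over [U]. *)
    rewrite big_split /= -[X in _ + X]mulr_sumr sumrB SU !sumr_const.
    rewrite -[X in X + _]mulr_natl -[A *+ _]mulr_natl -/N S2A.
    by rewrite subrr mulr0 addr0.
  by apply: ler_sum => f _; apply: pT; rewrite HN.
have hi : \sum_f p (H f) <= N * (q ^+ 2 * A * (M + N + 2 * q) + q ^+ 5).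
  rewrite (eq_bigr (fun f => H f ^+ 3 + (N + 2 * q) * H f ^+ 2 + (q ^+ 2 + 2 * q * N) * H f
    + N * q ^+ 2)); last first.
    by move=> f _; rewrite /p; ring.
  rewrite !big_split /= -!mulr_sumr H1 H2 H3 sumr_const S2A.
  have -> : q *+ #|(fun=> true) : pred V| = q ^+ 4.
    by rewrite -[LHS]mulr_natr (eq_card (B := {: V})) // !card_prod !natrM; ring.
  have : q ^+ 2 * \sum_x \sum_y w x y ^+ 3 <= q ^+ 2 * (M * (N * A)).
    by rewrite -S2A ler_wpM2l // sqr_ge0.
  by move: (\sum_x _) => T; nra.
by rewrite -(ler_pM2l N0); apply: le_trans hi.
Qed.

(** All members through the point meet [f], which misses it, and [meeting_through] allows at most
    [(q - 1) (q + 2) / 2] such polynomials. *)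
Lemma point_degree_le U x y f : pairwise_meeting U -> f \in U -> ev f x != y ->
  (point_degree U x y)%:R <= (q ^+ 2 + q) / 2 - 1.
Proof.
move=> h fU fxy; have := meeting_through fxy.
have : (point_degree U x y <= #|[set g : V | (ev g x == y) && (0 < meets g f)%N]|)%N.
  by apply/subset_leq_card/subsetP => g; rewrite !inE => /andP[gU ->]; rewrite h.
have q2 : (1 < #|F|)%N by rewrite (cardD1 0) (cardD1 1) !inE oner_eq0.
move=> le1 le2; have : (2 * point_degree U x y + 2 <= #|F| ^ 2 + #|F|)%N by nia.
by rewrite -(ler_nat K) !natrD natrX; lra.
Qed.

(** If every point is missed by some member, [point_degree_le] bounds all weights at once and
    [cubic_moment] applies; positivity of the excess will contradict this. *)
Lemma no_common_point U : pairwise_meeting U -> (0 < #|U|)%N ->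
  (forall x y, exists2 f, f \in U & ev f x != y) ->
  excess q #|U|%:R ((total_meets U)%:R / #|U|%:R - #|U|%:R) <= 0.
Proof.
move=> h U0 hP; rewrite /excess subr_le0; set N : K := #|U|%:R.
rewrite -[X in _ * (X + N + _)]/((q ^+ 2 + q) / 2 - 1 - N / q).
by apply: cubic_moment => // x y; have [f fU fxy] := hP x y; rewrite lerD2r (point_degree_le h fU).
Qed.

Lemma dense_natr U (c : nat) : (c * #|F| ^ 2 <= #|F| ^ 2 + c * #|U|)%N ->
  c%:R * q ^+ 2 <= q ^+ 2 + c%:R * #|U|%:R.
Proof. by rewrite -(ler_nat K) natrD !(natrM K c) natrX. Qed.

Lemma excess_family_odd U : pairwise_meeting U -> 2%:R != 0 :> F -> (11 <= #|F|)%N ->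
  (26 * #|F| ^ 2 <= #|F| ^ 2 + 26 * #|U|)%N ->
  0 < excess q #|U|%:R ((total_meets U)%:R / #|U|%:R - #|U|%:R).
Proof.
move=> h two; rewrite -(ler_nat K) => q11 /dense_natr hN.
set N : K := #|U|%:R in hN *; set S : K := (total_meets U)%:R.
have q0 := card_field_gt0; have qn0 := lt0r_neq0 q0.
have q20 : 0 < q ^+ 2 by rewrite exprn_gt0.
have N0 : 0 < N by nra.
have lin := coincidence_pairs_le K (fibres_bounded_quad h).
have tan := tangent_pairs_odd K U two.
have := total_meets_ge K h; rewrite -/N -/S.
move: lin tan; rewrite -/N; set L := (coincidence_pairs _ _)%:R; set T : K := (\sum_(f in U) _)%:R.
move=> lin tan hS.
apply: excess_odd => //; rewrite lerBrDr ler_pdivlMr //.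
(* Multiplied by [N], the bound required by [excess_odd] is [total_meets_ge] with both pair counts
   at their upper bounds. *)
have -> : (N - 1 - q - N / q + 2 * N / q ^+ 2 + N) * N =
  q * N + 2 * N * (N - 1) - (q - 1) * N - (q * N + N ^+ 2 / q - 2 * N ^+ 2 / q ^+ 2) by field.
lra.
Qed.

Lemma total_meets_ge_even U : pairwise_meeting U -> 2%:R = 0 :> F ->
  q * #|U|%:R + 2 * #|U|%:R * (#|U|%:R - 1) - (coincidence_pairs U (fun f => f.1.1))%:R
   - (coincidence_pairs U (fun f => f.1.2))%:R <= (total_meets U)%:R :> K.
Proof.
move=> h two; apply: le_trans (total_meets_ge K h).
by rewrite lerD2l lerN2 ler_nat tangent_pairs_even.
Qed.

Lemma excess_family_even U : pairwise_meeting U -> 2%:R = 0 :> F -> (8 <= #|F|)%N ->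
  (16 * #|F| ^ 2 <= #|F| ^ 2 + 16 * #|U|)%N ->
  0 < excess q #|U|%:R ((total_meets U)%:R / #|U|%:R - #|U|%:R).
Proof.
move=> h two; rewrite -(ler_nat K) => q8 /dense_natr hN.
have := total_meets_ge_even h two.
have lin1 := coincidence_pairs_le K (fibres_bounded_quad h).
have lin2 := coincidence_pairs_le K (fibres_bounded_lin h).
set N : K := #|U|%:R in hN lin1 lin2 *; set S : K := (total_meets U)%:R => hS.
have q0 := card_field_gt0; have qn0 := lt0r_neq0 q0.
have q20 : 0 < q ^+ 2 by rewrite exprn_gt0.
have N0 : 0 < N by nra.
apply: excess_even => //; rewrite lerBrDr ler_pdivlMr //.
lra.
Qed.

Lemma excess_family4 U : pairwise_meeting U -> 2%:R = 0 :> F -> #|F| = 4%N -> (15 <= #|U|)%N ->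
  0 < excess q #|U|%:R ((total_meets U)%:R / #|U|%:R - #|U|%:R).
Proof.
move=> h two F4 U15; have U16 := card_pairwise_meeting h; rewrite F4 in U16.
have := total_meets_ge_even h two.
have lin1 := coincidence_pairs_le_dense K (fibres_bounded_quad h).
have lin2 := coincidence_pairs_le_dense K (fibres_bounded_lin h).
rewrite F4 in lin1 lin2 *.
have N0 : 0 < #|U|%:R :> K by rewrite ltr0n; lia.
move=> hS; apply: excess4_gt0.
- rewrite lerBrDr ler_pdivlMr //; set N := #|U|%:R in hS lin1 lin2 N0 *.
  have Nn0 := lt0r_neq0 N0.
  have -> : (N - 4 + 2 * (4 - (16 - N)) * (16 - N) / N + N) * N =
    (2 * N - 4) * N + 2 * (4 - (16 - N)) * (16 - N) by field.
  move: lin1 lin2 hS; set L1 := _%:R; set L2 := (coincidence_pairs _ _)%:R.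
  lra.
have [->|->] : #|U| = 15%N \/ #|U| = 16%N by lia.
  by left.
by right.
Qed.
End Main.

(** * Parity of the field order and the case distinction on [q] *)

Lemma card_char2 (F : finFieldType) : 2%:R = 0 :> F -> exists n, #|F| = (2 ^ n.+1)%N.
Proof.
move=> two; have ch : 2%N \in [pchar F] by rewrite inE /= two eqxx.
have cF : #|F| = _ := card_pprimeChar ch; move: (logn _ _) cF => [|n] cF; last by exists n.
have : (1 < #|F|)%N by rewrite (cardD1 0) (cardD1 1) !inE oner_eq0.
by rewrite cF.
Qed.

Lemma odd_card_two (F : finFieldType) : odd #|F| -> 2%:R != 0 :> F.
Proof. by move=> oF; apply/eqP => /card_char2[n cF]; rewrite cF oddX in oF. Qed.

Lemma even_card_two (F : finFieldType) : ~~ odd #|F| -> 2%:R = 0 :> F.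
Proof.
have [p pr_p ch] := finPcharP F; have cF : #|F| = _ := card_pprimeChar ch.
rewrite cF oddX negb_or => /andP[_ /negbTE ep].
by have := even_prime pr_p; rewrite ep; case=> // e; have := ch; rewrite e inE => /andP[_ /eqP].
Qed.

Lemma common_point (F : finFieldType) (U : {set F * F * F}) : pairwise_meeting U ->
  (if odd #|F| then (9 < #|F|)%N else (2 < #|F|)%N) ->
  Rlt (intersect_bound #|F|) (INR #|U|) ->
  exists x y, forall f, f \in U -> ev f x = y.
Proof.
move=> h hq hN.
have [/existsP[x /existsP[y /forall_inP hxy]]|hP] :=
  boolP [exists x, exists y, [forall f in U, ev f x == y]].
  by exists x, y => f /hxy/eqP.
have {}hP x y : exists2 f, f \in U & ev f x != y.
  move: hP; rewrite negb_exists => /forallP/(_ x); rewrite negb_exists => /forallP/(_ y).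
  by rewrite negb_forall_in => /exists_inP.
have U0 : (0 < #|U|)%N.
  by have [f fU _] := hP 0 0; apply/card_gt0P; exists f.
have := no_common_point rat h U0 hP; rewrite leNgt => /negP[].
case: ifP hq => [oF q9 | /negbT oF q2].
  have q11 : (11 <= #|F|)%N by rewrite ltn_neqAle q9 andbT; apply: contraTneq oF => <-.
  by apply: excess_family_odd (bound_odd oF q11 hN) => //; exact: odd_card_two.
(* The orders are [2], which is excluded, then [4], [8], and powers of two from [16] on. *)
have two := even_card_two oF; have [[|[|[|n]]] cF] := card_char2 two.
- by rewrite cF in q2.
- by apply: excess_family4 => //; apply: bound4; rewrite cF in hN.
- apply: excess_family_even; rewrite ?cF //.
  by move: hN; rewrite cF => /bound8; lia.
have q16 : (16 <= #|F|)%N by rewrite cF -[16%N]/(2 ^ 4)%N leq_exp2l.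
by apply: excess_family_even => //; [exact: leq_trans q16 | exact: bound_even].
Qed.

(** * From coefficient triples back to polynomials *)

Definition coef_triple (F : finFieldType) (p : {poly F}) : F * F * F := (p`_2, p`_1, p`_0).

Lemma ev_coef_triple (F : finFieldType) (p : {poly F}) x :
  (size p <= 3)%N -> ev (coef_triple p) x = p.[x].
Proof.
move=> p3; rewrite (horner_coef_wide _ p3) !big_ord_recl big_ord0 /ev /=.
by rewrite expr0 expr1; ring.
Qed.

Lemma coef_triple_inj (F : finFieldType) (p r : {poly F}) :
  (size p <= 3)%N -> (size r <= 3)%N -> coef_triple p = coef_triple r -> p = r.
Proof.
move=> p3 r3 [e2 e1 e0]; apply/polyP => -[|[|[|i]]] //.
by rewrite !nth_default // ?(leq_trans p3) ?(leq_trans r3).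
Qed.

Theorem theorem1 (F : finFieldType) (U : seq {poly F}) :
  uniq U ->
  (if odd #|F| then (9 < #|F|)%N else (2 < #|F|)%N) ->
  (forall g, g \in U -> (size g <= 3)%N) ->
  intersecting U ->
  Rlt (intersect_bound #|F|) (INR (size U)) ->
  exists alpha beta : F, forall g, g \in U -> g.[alpha] = beta.
Proof.
move=> uU hq deg hU hN; pose W := [set f in map (@coef_triple F) U].
have cW : #|W| = size U.
  rewrite cardsE -(size_map (@coef_triple F)); apply/card_uniqP.
  by rewrite map_inj_in_uniq // => p r /deg p3 /deg r3; apply: coef_triple_inj.
have meetW : pairwise_meeting W.
  move=> f g; rewrite !inE => /mapP[p pU ->] /mapP[r rU ->].
  have /set0Pn[z] := hU p r pU rU.
  rewrite inE => /andP[/imsetP[x _ ->] /imsetP[y _ [<- e]]].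
  by apply/card_gt0P; exists x; rewrite inE !ev_coef_triple ?deg // e.
rewrite -cW in hN; have [x [y hxy]] := common_point meetW hq hN.
exists x, y => g gU; rewrite -ev_coef_triple ?deg //; apply: hxy.
by rewrite inE map_f.
Qed.
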